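(* Let $M$ be a connected elementary split matroid of rank $k$ on an $n$-element ground set $E$, where $n\ge 4$, and let $e\in E$ be such that $M\setminus e$ and $M/e$ are both connected. Let $v\in E\setminus\{e\}$, let $\prec$ be a total order on $E$, and let $\mathcal{R}_{e,v}$ be the family of pairs $(R_F,s_F)$ constructed from $M,e,v,\prec$ as described in the context. Then there exists a connected elementary split matroid $N_{e,v}$ of rank $k-1$ on $E'=E\setminus\{e,v\}$ whose proper cyclic flats are exactly the sets $R_F$ occurring in $\mathcal{R}_{e,v}$, with $\operatorname{rk}_{N_{e,v}}(R_F)=s_F$ for every $(R_F,s_F)\in\mathcal{R}_{e,v}$.
   Context: All matroids are finite, and connected matroids are required to have nonempty ground sets. **Cyclic flats.** A subset $A$ of the ground set of a matroid is cyclic if it is a (possibly empty) union of circuits; a cyclic flat is a flat that is cyclic. If $M$ is loopless and coloopless with ground set $E$, then $\varnothing$ and $E$ are cyclic flats; the remaining cyclic flats are called proper, and $\mathcal{Z}^{\circ}(M)$ denotes the set of proper cyclic flats. A loopless, coloopless matroid is elementary split if and only if its proper cyclic flats are pairwise incomparable under inclusion. (Connected matroids on at least two elements are loopless and coloopless.) **Parameters.** For $F\in\mathcal{Z}^{\circ}(M)$ write $r_F=\operatorname{rk}_M(F)$, $h_F=|F|$, $p_F=k-r_F$, $b_F=h_F-r_F$. **Construction of $\mathcal{R}_{e,v}$.** All minima are taken with respect to $\prec$. (1) For each $F\in\mathcal{Z}^{\circ}(M)$ with $e\in F$ and $b_F\ge 2$, put $s_F=r_F-1$, $x_F=\min(F\setminus\{e\})$,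 and \[ R_F=\begin{cases}F\setminus\{e,v\},& v\in F,\\ F\setminus\{e,x_F\},& v\notin F.\end{cases} \] (2) For each $F\in\mathcal{Z}^{\circ}(M)$ with $e\notin F$ and $p_F\ge 2$, put $s_F=r_F$, $y_F=\min\bigl(E\setminus(F\cup\{e\})\bigr)$, and \[ R_F=\begin{cases}F,& v\notin F,\\ (F\setminus\{v\})\cup\{y_F\},& v\in F.\end{cases} \] (Under the stated hypotheses the sets over which the minima are taken are nonempty.) Then $\mathcal{R}_{e,v}$ is the family of all pairs $(R_F,s_F)$ arising from (1) and (2); the proper cyclic flats $F$ satisfying neither condition contribute nothing. *)

(* Defs.v *)
From mathcomp Require Import all_boot.

Set Implicit Arguments.
Unset Strict Implicit.
Unset Printing Implicit Defensive.

(* A finite matroid on the ground set [ground] inside the ambient finite type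
   [T], given by its rank function.  The rank function is extended from subsets
   of [ground] to all subsets of [T] by A |-> rk (A :&: ground); [rk_ground]
   pins down this extension. *)
Record matroid (T : finType) := Matroid {
  ground : {set T};
  rk : {set T} -> nat;
  rk_ground : forall A : {set T}, rk (A :&: ground) = rk A;
  rk_le_card : forall A : {set T}, rk A <= #|A|;
  rk_mono : forall A B : {set T}, A \subset B -> rk A <= rk B;
  rk_submod : forall A B : {set T},
    rk (A :|: B) + rk (A :&: B) <= rk A + rk B
}.

Section MatroidDefs.
Variables (T : finType) (M : matroid T).
Implicit Types (A B C F X : {set T}) (x : T).

Definition indep A := (A \subset ground M) && (rk M A == #|A|).

Definition basis B := maxset indep B.

Definition circuit C :=
  minset [pred A : {set T} | (A \subset ground M) && ~~ indep A] C.

Definition loopless := [forall x in ground M, ~~ circuit [set x]].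

Definition coloop x := (x \in ground M) && [forall B, basis B ==> (x \in B)].

Definition coloopless := [forall x in ground M, ~~ coloop x].

Definition connected :=
  (ground M != set0) &&
  [forall x in ground M, forall y in ground M, (x != y) ==>
     [exists C, [&& circuit C, x \in C & y \in C]]].

Definition flat A :=
  (A \subset ground M) &&
  [forall x in ground M :\: A, rk M A < rk M (x |: A)].

Definition cyclic_set A :=
  [exists S : {set {set T}}, [forall C in S, circuit C] && (A == cover S)].

Definition proper_cyclic_flats : {set {set T}} :=
  [set F | [&& flat F, cyclic_set F, F != set0 & F != ground M]].

(* Proper cyclic flats, and hence this description of elementary split
   matroids, are meant for loopless and coloopless matroids only; connected
   matroids with at least two elements are of this kind. *)
Definition elementary_split :=
  [&& loopless, coloopless &
      [forall F in proper_cyclic_flats, forall G in proper_cyclic_flats,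
         (F \subset G) ==> (F == G)]].

Lemma deletion_rk_ground X A :
  rk M ((A :&: (ground M :\: X)) :\: X) = rk M (A :\: X).
Proof.
rewrite -[RHS]rk_ground; congr (rk M _).
by apply/setP=> x; rewrite !inE; do !case: (x \in _).
Qed.

Lemma deletion_rk_le_card X A : rk M (A :\: X) <= #|A|.
Proof.
by apply: leq_trans (rk_le_card M _) _; rewrite subset_leq_card ?subsetDl.
Qed.

Lemma deletion_rk_mono X A B :
  A \subset B -> rk M (A :\: X) <= rk M (B :\: X).
Proof. by move=> sAB; apply: rk_mono; apply: setSD. Qed.

Lemma deletion_rk_submod X A B :
  rk M ((A :|: B) :\: X) + rk M ((A :&: B) :\: X)
    <= rk M (A :\: X) + rk M (B :\: X).
Proof. by rewrite setDUl setDIl; apply: rk_submod. Qed.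

Definition deletion X : matroid T :=
  @Matroid T (ground M :\: X) (fun A => rk M (A :\: X))
    (deletion_rk_ground X) (deletion_rk_le_card X)
    (@deletion_rk_mono X) (deletion_rk_submod X).

Lemma contraction_rk_ground X A :
  rk M ((A :&: (ground M :\: X)) :|: X) - rk M X = rk M (A :|: X) - rk M X.
Proof.
congr (_ - _); rewrite -rk_ground -[RHS]rk_ground; congr (rk M _).
by apply/setP=> x; rewrite !inE; do !case: (x \in _).
Qed.

Lemma contraction_rk_le_card X A : rk M (A :|: X) - rk M X <= #|A|.
Proof.
rewrite leq_subLR addnC.
apply: leq_trans (leq_addr (rk M (A :&: X)) _) _.
by apply: leq_trans (rk_submod M A X) _; rewrite leq_add2r rk_le_card.
Qed.

Lemma contraction_rk_mono X A B :
  A \subset B -> rk M (A :|: X) - rk M X <= rk M (B :|: X) - rk M X.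
Proof. by move=> sAB; apply/leq_sub2r/rk_mono/setSU. Qed.

Lemma contraction_rk_submod X A B :
  (rk M ((A :|: B) :|: X) - rk M X) + (rk M ((A :&: B) :|: X) - rk M X)
    <= (rk M (A :|: X) - rk M X) + (rk M (B :|: X) - rk M X).
Proof.
have leX C : rk M X <= rk M (C :|: X) by apply/rk_mono/subsetUr.
rewrite -(leq_add2r (rk M X + rk M X)) addnACA [leqRHS]addnACA !subnK //.
by rewrite setUIl setUUl; apply: rk_submod.
Qed.

Definition contraction X : matroid T :=
  @Matroid T (ground M :\: X) (fun A => rk M (A :|: X) - rk M X)
    (contraction_rk_ground X) (contraction_rk_le_card X)
    (@contraction_rk_mono X) (contraction_rk_submod X).

End MatroidDefs.

Definition total_order_on (T : finType) (E : {set T}) (le : rel T) : Prop :=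
  [/\ {in E &, total le}, {in E &, antisymmetric le}
    & {in E & &, transitive le}].

(* The le-minimum of [S]; the default [x0] is returned only when there is no
   minimum, e.g. when [S] is empty. *)
Definition set_min (T : finType) (le : rel T) (x0 : T) (S : {set T}) : T :=
  odflt x0 [pick x in S | [forall y in S, le x y]].

Section Family.
Variables (T : finType) (M : matroid T) (e v : T) (le : rel T).
Implicit Type F : {set T}.

Definition R_in F : {set T} :=
  if v \in F then F :\: [set e; v]
  else F :\: [set e; set_min le e (F :\ e)].

Definition R_out F : {set T} :=
  if v \in F then (F :\ v) :|: [set set_min le e (ground M :\: (e |: F))]
  else F.

Definition R_family : seq ({set T} * nat) :=
  [seq (R_in F, rk M F - 1)
     | F <- enum (proper_cyclic_flats M)
     & (e \in F) && (2 <= #|F| - rk M F)] ++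
  [seq (R_out F, rk M F)
     | F <- enum (proper_cyclic_flats M)
     & (e \notin F) && (2 <= rk M (ground M) - rk M F)].

End Family.

(* Main.v *)
Require Import Defs.
From mathcomp Require Import all_boot.
From mathcomp Require Import zify.

(** A rank-[k] elementary split matroid is determined by its proper cyclic
    flats: if these are the sets [R_i], of rank [s_i], then
      [rk A = min (#|A|, k, min_i (s_i + #|A :\: R_i|))].
    Conversely, this formula is the rank function of a matroid as soon as any
    two parts satisfy [#|R_i :&: R_j| + k <= s_i + s_j]
    ([split_rank_submod]).  Mild inequalities saying that no [R_i] has rank 0,
    nullity 0, full rank, or coloops in its complement then make the [R_i]
    exactly the proper cyclic flats.  Such a matroid is disconnected only if
    two parts of it split the ground set with ranks adding up to [k]
    ([split_matroid_connected]).

    So everything reduces to numerical properties of the pairs built from [M].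
    In [M], distinct proper cyclic flats satisfy
    [#|F :&: G| + rk E <= rk F + rk G], since their join has full rank and
    their meet is independent ([split_cyclic_flats_meet]).  Passing from [F]
    to [R_F] lowers [rk E] by one; it also lowers [rk F] by one when [e] is in
    [F].  Thus the intersection has to shrink by one for two flats containing
    [e], where [e] itself is lost; it must not grow when just one of them
    contains [e]; and it may grow by one when neither does.  Only the middle
    case is delicate: the element [y_G] added to [G] in place of [v] could be
    in [F] while the element [x_F] removed from [F] lies outside [G].  Then
    each of the two is a candidate in the minimum defining the other, so
    [x_F = y_G], and no growth occurs ([meet_in_out]).  This is why both
    choices have to be made with respect to the same order.

    Connectedness of the two minors supplies the rest: if [M / e] has no loops
    then [rk F >= 2] whenever [e] is in [F], so [s_F > 0]; if [M \ e] has no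
    coloops then the complement of [F] keeps enough elements when [e] is not
    in [F].  Finally, two of the new sets can separate the new ground set only if
    the flats they come from separate [M] ([reduced_no_separation]). *)

Set Implicit Arguments.
Unset Strict Implicit.
Unset Printing Implicit Defensive.

Lemma setDAC (T : finType) (A B C : {set T}) : A :\: B :\: C = A :\: C :\: B.
Proof. by rewrite !setDDl setUC. Qed.

(** * Rank, circuits and cyclic flats *)

Section MatroidFacts.
Variables (T : finType) (M : matroid T).
Implicit Types (A B C D F G I U X : {set T}) (x y z : T).

Local Notation E := (ground M).
Local Notation r := (rk M).

Lemma rk_set0 : r set0 = 0.
Proof. by apply/eqP; rewrite -leqn0 -(cards0 T) rk_le_card. Qed.

Lemma rk_setU1_leq x A : r (x |: A) <= (r A).+1.
Proof.
have := rk_submod M [set x] A; have := rk_le_card M [set x].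
by rewrite cards1; lia.
Qed.

Lemma rk_setU_span A B D :
  A \subset B -> r (D :|: A) = r A -> r (D :|: B) = r B.
Proof.
move=> sAB eqA; apply/eqP; rewrite eqn_leq [r B <= _]rk_mono ?subsetUr // andbT.
have := rk_submod M (D :|: A) B.
rewrite -setUA (setUidPr sAB).
have: r A <= r ((D :|: A) :&: B) by rewrite rk_mono // subsetI subsetUr.
by lia.
Qed.

Lemma rk_sub_indep A B : A \subset B -> r B = #|B| -> r A = #|A|.
Proof.
move=> sAB rB; apply/eqP; rewrite eqn_leq rk_le_card /=.
have := rk_submod M A (B :\: A); have := rk_le_card M (B :\: A).
have := cardsID A B; rewrite (setIidPr sAB) setDE setUIr setUCr setIT.
by rewrite (setUidPr sAB); lia.
Qed.

(** By maximality: a largest subset of [A] spanned by [I] absorbs any further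
    element of [A]. *)
Lemma rk_span_all I A : I \subset A ->
  (forall x, x \in A -> r (x |: I) = r I) -> r A = r I.
Proof.
move=> sIA spanI.
pose P := [pred D : {set T} | (D \subset A) && (r (D :|: I) == r I)].
have P0 : P set0 by rewrite /P /= sub0set set0U /=.
have [D /maxsetP[/andP[sDA /eqP rD] maxD] _] := maxset_exists P0.
suff AD : A \subset D by rewrite -rD (setUidPl (subset_trans sIA AD));
  congr (r _); apply/eqP; rewrite eqEsubset AD.
apply/subsetP => x xA.
have <- : x |: D = D; last by rewrite setU11.
apply: maxD; last exact: subsetUr.
rewrite inE subUset sub1set xA sDA /= -setUA.
by rewrite (@rk_setU_span I) ?subsetUr ?spanI ?rD.
Qed.

Lemma indep_spanning_subset A :
  exists2 I : {set T}, I \subset A & r I = #|I| /\ r A = r I.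
Proof.
pose P := [pred I : {set T} | (I \subset A) && (r I == #|I|)].
have P0 : P set0 by rewrite /P /= sub0set rk_set0 cards0 /=.
have [I /maxsetP[/andP[sIA /eqP rI] maxI] _] := maxset_exists P0.
exists I => //; split=> //; apply: rk_span_all => // x xA.
case: (boolP (x \in I)) => [xI | xI]; first by rewrite (setUidPr _) ?sub1set.
apply/eqP; rewrite eqn_leq [r I <= _]rk_mono ?subsetUr // andbT leqNgt.
apply: contra xI => lt_r.
have <- : x |: I = I; last by rewrite setU11.
apply: maxI; last exact: subsetUr.
rewrite inE subUset sub1set xA sIA /= eqn_leq rk_le_card /=.
by have := cardsU1 x I; case: (x \in I) => /=; lia.
Qed.

Lemma circuit_sub C : circuit M C -> C \subset E.
Proof. by case/minsetP => /andP[]. Qed.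

Lemma circuit_rk C : circuit M C -> r C < #|C|.
Proof.
case/minsetP => /andP[sCE]; rewrite /indep sCE /= => rC _.
by rewrite ltn_neqAle rC rk_le_card.
Qed.

Lemma circuit_proper_rk C D : circuit M C -> D \proper C -> r D = #|D|.
Proof.
case/minsetP => /andP[sCE _] minC; rewrite properEneq => /andP[neDC sDC].
apply/eqP; apply: contraNT neDC => rD; apply/eqP/minC => //.
by rewrite inE /indep (subset_trans sDC sCE) rD.
Qed.

Lemma dependent_circuit A : A \subset E -> r A < #|A| ->
  exists2 C : {set T}, circuit M C & C \subset A.
Proof.
move=> sAE ltA.
have PA : [pred A : {set T} | (A \subset E) && ~~ indep M A] A.
  by rewrite /= /indep sAE /= neq_ltn ltA.
by have [C minC sCA] := minset_exists PA; exists C.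
Qed.

Lemma rk_del_circuit C A x :
  circuit M C -> x \in C -> C \subset A -> r (A :\ x) = r A.
Proof.
move=> cC xC sCA; apply/eqP; rewrite eqn_leq rk_mono ?subsetDl //=.
have := rk_submod M (A :\ x) C.
have -> : (A :\ x) :|: C = A.
  apply/setP => z; rewrite !inE; case: eqP => [-> | _] /=.
    by rewrite xC (subsetP sCA).
  by apply/orP/idP => [[//|/(subsetP sCA)] | ->]; [| left].
have -> : (A :\ x) :&: C = C :\ x.
  apply/setP => z; rewrite !inE -andbA.
  by case: (boolP (z \in C)) => [/(subsetP sCA) -> | _]; rewrite ?andbF.
rewrite (circuit_proper_rk cC (properD1 xC)).
by have := circuit_rk cC; rewrite (cardsD1 x C) xC; lia.
Qed.

(** A basis of [A :\ x] becomes dependent when [x] is added, and every circuit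
    this creates goes through [x]. *)
Lemma circuit_through A x : A \subset E -> x \in A -> r (A :\ x) = r A ->
  exists C : {set T}, [/\ circuit M C, x \in C & C \subset A].
Proof.
move=> sAE xA eqr; have [I sI [rI rA]] := indep_spanning_subset (A :\ x).
have xNI : x \notin I by apply/negP => /(subsetP sI); rewrite setD11.
have sIA : x |: I \subset A.
  by rewrite subUset sub1set xA (subset_trans sI) ?subsetDl.
have [|| C cC sC] := @dependent_circuit (x |: I).
- exact: subset_trans sIA sAE.
- by have := rk_mono M sIA; rewrite cardsU1 xNI; lia.
exists C; split => //; last exact: subset_trans sC sIA.
apply: contraT => xNC; have := circuit_rk cC.
suff sCI : C \subset I by rewrite (rk_sub_indep sCI rI) ltnn.
apply/subsetP => z zC; move: (subsetP sC _ zC).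
by rewrite !inE => /orP[/eqP ez | //]; rewrite -ez zC in xNC.
Qed.

(** Cyclic means that the restriction to [A] has no coloops; in this form
    cyclicity can be read off the rank function. *)
Lemma cyclic_setP A : A \subset E ->
  reflect (forall x, x \in A -> r (A :\ x) = r A) (cyclic_set M A).
Proof.
move=> sAE; apply: (iffP existsP) => [[S /andP[/forallP cS /eqP defA]] x | rA].
  rewrite {1}defA => /bigcupP[C CS xC].
  apply: (@rk_del_circuit C) => //; first exact: (implyP (cS C) CS).
  by rewrite defA; apply: bigcup_sup.
exists [set C : {set T} | circuit M C & C \subset A].
apply/andP; split; first by apply/forallP => C; apply/implyP; rewrite inE => /andP[].
rewrite eqEsubset; apply/andP; split; last first.
  by apply/bigcupsP => C; rewrite inE => /andP[].
apply/subsetP => x xA; have [C [cC xC sCA]] := circuit_through sAE xA (rA x xA).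
by apply/bigcupP; exists C => //; rewrite inE cC.
Qed.

Lemma flat_rk A B : flat M A -> B \subset E -> A \proper B -> r A < r B.
Proof.
case/andP=> sAE /forallP fA sBE /properP[sAB [x xB xNA]].
have /implyP := fA x; rewrite !inE xNA (subsetP sBE) // => /(_ isT) lt.
by apply: leq_trans lt _; rewrite rk_mono // subUset sub1set xB.
Qed.

Lemma proper_cyclic_flatP F :
  reflect [/\ F \subset E, flat M F, forall x, x \in F -> r (F :\ x) = r F,
              F != set0 & F != E]
          (F \in proper_cyclic_flats M).
Proof.
rewrite inE; apply: (iffP and4P) => [[fF cF F0 FE] | [sF fF cF F0 FE]].
  have sF : F \subset E by case/andP: fF.
  by split => //; apply/cyclic_setP.
by split => //; apply/cyclic_setP.
Qed.

Arguments proper_cyclic_flatP {F}.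

(** The flat is the closure of [A], obtained as a maximal set of the same rank:
    the elements added to [A] are spanned by [A], so they are not coloops. *)
Lemma cyclic_in_proper_flat A : A \subset E -> A != set0 ->
  (forall x, x \in A -> r (A :\ x) = r A) -> r A < r E ->
  exists2 X : {set T}, X \in proper_cyclic_flats M & A \subset X /\ r X = r A.
Proof.
move=> sAE A0 cA ltA.
pose P := [pred X : {set T} | (X \subset E) && (r X == r A)].
have PA : P A by rewrite /P /= sAE /=.
have [X /maxsetP[/andP[sXE /eqP rX] maxX] sAX] := maxset_exists PA.
exists X => //; apply/proper_cyclic_flatP; split=> //.
- apply/andP; split => //; apply/forallP => x; apply/implyP.
  rewrite inE => /andP[xNX xE].
  rewrite ltn_neqAle rk_mono ?subsetUr // andbT.
  apply: contra xNX => /eqP eqx.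
  have <- : x |: X = X; last by rewrite setU11.
  apply: maxX; last exact: subsetUr.
  by rewrite inE subUset sub1set xE sXE -eqx rX /=.
- move=> x xX; case: (boolP (x \in A)) => xA.
    rewrite -{2}(setD1K xX) (@rk_setU_span (A :\ x)) ?setSD //.
    by rewrite setD1K // cA.
  apply/eqP; rewrite eqn_leq rk_mono ?subsetDl //= rX rk_mono //.
  apply/subsetP => z zA; rewrite !inE (subsetP sAX) // andbT.
  by apply: contra xA => /eqP <-.
- by apply: contra A0 => /eqP X0; rewrite -subset0 -X0.
- by apply: contraL ltA => /eqP <-; rewrite rX ltnn.
Qed.

Lemma proper_cyclic_flat_card F : F \in proper_cyclic_flats M -> r F < #|F|.
Proof.
case/proper_cyclic_flatP => _ _ cF /set0Pn[x xF] _.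
by rewrite -(cF x xF) (cardsD1 x F) xF add1n ltnS rk_le_card.
Qed.

Lemma proper_cyclic_flat_rk F : F \in proper_cyclic_flats M -> r F < r E.
Proof.
by case/proper_cyclic_flatP => sF fF _ _ FE; apply: flat_rk; rewrite ?properEneq ?FE.
Qed.

(** In terms of the lattice of cyclic flats: two incomparable atoms that are
    also coatoms.  The closure of [F :|: G] would be a larger proper cyclic flat
    if [F :|: G] did not span, and the closure of a circuit inside [F :&: G]
    would be a smaller one; so the inequality is submodularity. *)
Lemma split_cyclic_flats_meet F G : elementary_split M ->
  F \in proper_cyclic_flats M -> G \in proper_cyclic_flats M -> F != G ->
  #|F :&: G| + r E <= r F + r G.
Proof.
case/and3P=> _ _ /forallP split_M FZ GZ neFG.
have split_eq (X Y : {set T}) : X \in proper_cyclic_flats M ->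
    Y \in proper_cyclic_flats M -> X \subset Y -> X = Y.
  move=> XZ YZ sXY; have /implyP/(_ XZ)/forallP/(_ Y) := split_M X.
  by move=> /implyP/(_ YZ)/implyP/(_ sXY)/eqP.
have [sF fF cF F0 FE] := proper_cyclic_flatP FZ.
have [sG fG cG G0 GE] := proper_cyclic_flatP GZ.
have joinE : r (F :|: G) = r E.
  have sFG : F :|: G \subset E by rewrite subUset sF.
  apply/eqP; rewrite eqn_leq rk_mono //= leqNgt; apply/negP => ltFG.
  have [||X XZ [sX _]] := cyclic_in_proper_flat sFG _ _ ltFG.
  - by apply: contra F0 => /eqP U0; rewrite -subset0 -U0 subsetUl.
  - have cU (Y : {set T}) x : Y \subset F :|: G -> x \in Y -> r (Y :\ x) = r Y ->
        r ((F :|: G) :\ x) = r (F :|: G).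
      move=> sY xY eqY; rewrite -{2}(setD1K (subsetP sY _ xY)).
      by rewrite (@rk_setU_span (Y :\ x)) ?setSD // setD1K.
    by move=> x; case/setUP => xY;
      [apply: (cU F) | apply: (cU G)]; rewrite ?subsetUl ?subsetUr ?cF ?cG.
  case/negP: neFG; apply/eqP.
  have -> : F = X by apply: split_eq => //; apply: subset_trans sX; apply: subsetUl.
  by apply/esym/split_eq => //; apply: subset_trans sX; apply: subsetUr.
have meetE : r (F :&: G) = #|F :&: G|.
  apply/eqP; rewrite eqn_leq rk_le_card /= leqNgt; apply/negP => ltFG.
  have [|C cC sC] := dependent_circuit _ ltFG.
    by rewrite (subset_trans (subsetIl _ _)).
  have rC x : x \in C -> r (C :\ x) = r C by move=> xC; apply: (rk_del_circuit cC).
  have ltC : r C < r E.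
    apply: leq_ltn_trans (proper_cyclic_flat_rk FZ).
    by rewrite rk_mono // (subset_trans sC) ?subsetIl.
  have [|X XZ [sX rX]] := cyclic_in_proper_flat (circuit_sub cC) _ rC ltC.
    by apply: contraTneq (circuit_rk cC) => ->; rewrite cards0.
  have sub_flat (Y : {set T}) : flat M Y -> C \subset Y -> X \subset Y.
    move=> fY sCY; apply/subsetP => x xX; apply: contraT => xNY.
    have sYE : Y \subset E by case/andP: fY.
    have [sXE _ _ _ _] := proper_cyclic_flatP XZ.
    have: r Y < r (x |: Y).
      apply: (flat_rk fY); last by rewrite properUr // sub1set.
      by rewrite subUset sub1set sYE (subsetP sXE).
    rewrite (@rk_setU_span C) ?ltnn //.
    apply/eqP; rewrite eqn_leq [r C <= _]rk_mono ?subsetUr // andbT -rX rk_mono //.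
    by rewrite subUset sub1set xX.
  have [sCF sCG] := (subset_trans sC (subsetIl F G), subset_trans sC (subsetIr F G)).
  case/negP: neFG; apply/eqP.
  have <- : X = F by apply: split_eq => //; apply: sub_flat.
  by apply: split_eq => //; apply: sub_flat.
by have := rk_submod M F G; rewrite joinE meetE; clear; lia.
Qed.

Lemma connected_circuit x y : connected M -> x \in E -> y \in E -> x != y ->
  exists C : {set T}, [/\ circuit M C, x \in C & y \in C].
Proof.
case/andP=> _ /forallP conn xE yE nexy.
have /implyP/(_ xE)/forallP/(_ y)/implyP/(_ yE)/implyP/(_ nexy) := conn x.
by case/existsP => C /and3P[]; exists C.
Qed.

(** Adding a circuit [C] that meets both sides to [U] raises the rank by less
    than [#|C :\: U|], as [C] is dependent while its two pieces are not. *)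
Lemma connected_separation U x y : connected M -> U \subset E ->
  x \in U -> y \in E :\: U -> r E < r U + r (E :\: U).
Proof.
move=> conn sUE xU; rewrite inE => /andP[yNU yE].
have nexy : x != y by apply: contraNneq yNU => <-.
have [C [cC xC yC]] := connected_circuit conn (subsetP sUE _ xU) yE nexy.
have sCE := circuit_sub cC.
have := rk_submod M U C; have := rk_submod M (U :|: C) (E :\: U).
have -> : (U :|: C) :|: (E :\: U) = E.
  apply/setP => z; rewrite !inE.
  have /implyP := subsetP sUE z; have /implyP := subsetP sCE z.
  by do 3!case: (_ \in _).
have -> : (U :|: C) :&: (E :\: U) = C :\: U.
  apply/setP => z; rewrite !inE; have /implyP := subsetP sCE z.
  by do 3!case: (_ \in _).
have -> : r (C :\: U) = #|C :\: U|.
  apply: (circuit_proper_rk cC); apply/properP; split; first exact: subsetDl.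
  by exists x; rewrite // inE xU.
have -> : r (U :&: C) = #|U :&: C|.
  apply: (circuit_proper_rk cC); apply/properP; split; first exact: subsetIr.
  by exists y; rewrite // inE (negPf yNU).
by have := cardsID U C; have := circuit_rk cC; rewrite setIC; clear; lia.
Qed.

Lemma rk_leq_diff A B : r A <= r B + #|A :\: B|.
Proof.
have sA : A \subset B :|: (A :\: B).
  by apply/subsetP => z zA; rewrite !inE zA andbT orbN.
have := rk_mono M sA; have := rk_submod M B (A :\: B).
by have := rk_le_card M (A :\: B); clear; lia.
Qed.

Lemma connected_rk1 x : connected M -> 1 < #|E| -> x \in E -> r [set x] = 1.
Proof.
move=> conn; rewrite (cardsD1 x) => + xE; rewrite xE ltnS => /card_gt0P[y].
rewrite !inE => /andP[neyx yE]; have [C [cC yC xC]] := connected_circuit conn yE xE neyx.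
rewrite (circuit_proper_rk cC) ?cards1 //; apply/properP.
by split; rewrite ?sub1set //; exists y; rewrite // inE.
Qed.

Lemma connected_rkD1 x : connected M -> 1 < #|E| -> x \in E -> r (E :\ x) = r E.
Proof.
move=> conn; rewrite (cardsD1 x) => + xE; rewrite xE ltnS => /card_gt0P[y].
rewrite !inE => /andP[neyx yE]; have [C [cC yC xC]] := connected_circuit conn yE xE neyx.
exact: rk_del_circuit cC xC (circuit_sub cC).
Qed.

(** Otherwise every element outside [F] would be a coloop. *)
Lemma proper_cyclic_flat_co F : connected M -> 1 < #|E| ->
  F \in proper_cyclic_flats M -> r E + #|F| < #|E| + r F.
Proof.
move=> conn E1 /proper_cyclic_flatP[sF _ _ _ FE].
have [y yE yNF] : exists2 y, y \in E & y \notin F.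
  by apply/subsetPn; apply: contra FE => sEF; rewrite eqEsubset sF.
have := rk_leq_diff (E :\ y) F; rewrite connected_rkD1 //.
have := cardsD1 y (E :\: F); have := cardsID F E; rewrite (setIidPr sF).
by rewrite inE yNF yE setDDl setDDl setUC; clear; lia.
Qed.

(** The converse of [connected_separation], in the manner of Tutte's linking
    theorem.  A minor [(M | A) / I] is linked when no separation of it
    separates [x] from [y]; an element [z] other than [x] and [y] can always be
    deleted or contracted so as to keep the minor linked, because a separation of
    the deletion and one of the contraction would uncross to a separation of the
    minor itself.
    In a linked minor on [x] and [y] alone, these two are parallel, which gives
    a circuit of [M] in [x |: (y |: I)] through both. *)
Lemma linked_circuit x y : x \in E -> y \in E -> x != y ->
  (forall U, U \subset E -> x \in U -> y \notin U -> r E < r U + r (E :\: U)) ->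
  exists C : {set T}, [/\ circuit M C, x \in C & y \in C].
Proof.
move=> xE yE nexy linked.
pose link I A := forall U V, U :|: V = A -> U :&: V = I -> x \in U -> y \in V ->
  r A + r I < r U + r V.
suff minor m I A : #|A :\: I| <= m -> I \subset A -> A \subset E ->
    x \in A :\: I -> y \in A :\: I -> link I A ->
    exists C : {set T}, [/\ circuit M C, x \in C & y \in C].
  apply: (minor #|E| set0 E) => //; rewrite ?setD0 ?sub0set // => U V UV UV0 xU yV.
  have eV : V = E :\: U.
    apply/setP => z; move/setP/(_ z): UV; move/setP/(_ z): UV0; rewrite !inE.
    by do 3!case: (z \in _).
  rewrite rk_set0 addn0 eV; move: yV; rewrite eV inE => /andP[yNU _].
  by apply: linked; rewrite // -UV subsetUl.
elim: m I A => [|m IHm] I A leAI sIA sAE xAI yAI lkA.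
  by move: leAI xAI; rewrite leqn0 cards_eq0 => /eqP ->; rewrite inE.
have [/andP[xNI xA] /andP[yNI yA]] : (x \notin I) && (x \in A) /\ (y \notin I) && (y \in A).
  by move: xAI yAI; rewrite !inE.
case: (boolP (A :\: I \subset [set x; y])) => [sxy | /subsetPn[z]].
  have eA : A = x |: (y |: I).
    apply/setP => z; rewrite !inE; have /implyP := subsetP sxy z; have /implyP := subsetP sIA z.
    rewrite !inE; case: eqP => [-> | _]; first by rewrite xA.
    case: eqP => [-> | _]; first by rewrite yA.
    by do 2!case: (z \in _) => //=; auto.
  have lk : r A + r I < r (x |: I) + r (y |: I).
    apply: lkA; rewrite ?setU11 //.
      by rewrite eA; apply/setP => z; rewrite !inE; do !case: (_ == _); case: (_ \in _).
    apply/setP => z; rewrite !inE; case: (boolP (z \in I)) => zI; first by rewrite !orbT.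
    by rewrite !orbF; apply: contraNF nexy => /andP[/eqP <- /eqP <-].
  have leI := rk_setU1_leq y I.
  have le1 : r (y |: I) <= r A by rewrite rk_mono // eA subsetUr.
  have Ax : A :\ x = y |: I.
    rewrite eA setU1K // !inE negb_or nexy //.
  have [|C [cC xC sC]] := circuit_through sAE xA.
    rewrite Ax; apply/eqP; rewrite eqn_leq le1 /=.
    by move: lk leI (rk_setU1_leq x I); clear; lia.
  exists C; split=> //; apply: contraT => yNC.
  have sCx : C \subset x |: I.
    apply/subsetP => z zC; have := subsetP sC _ zC; rewrite eA !inE.
    by case/or3P => [-> //|/eqP ez|->]; [rewrite ez (negPf yNC) in zC | rewrite orbT].
  have eqI := rk_del_circuit cC xC sCx; rewrite setU1K // in eqI.
  by move: lk le1; rewrite eqI; clear; lia.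
rewrite !inE negb_or => /andP[zNI zA] /andP[nezx nezy].
have card_z : #|(A :\: I) :\ z| <= m.
  by move: leAI; rewrite (cardsD1 z (A :\: I)) inE zNI zA.
have [Azi Azd] : A :\: (z |: I) = (A :\: I) :\ z /\ (A :\ z) :\: I = (A :\: I) :\ z.
  by split; apply/setP => w; rewrite !inE; do !case: (_ \in _); case: (_ == _).
have sep (I' A' : {set T}) : #|A' :\: I'| <= m -> I' \subset A' -> A' \subset E ->
    x \in A' :\: I' -> y \in A' :\: I' ->
    (exists C : {set T}, [/\ circuit M C, x \in C & y \in C]) \/
    (exists U V, [/\ U :|: V = A', U :&: V = I', x \in U, y \in V &
       r U + r V <= r A' + r I']).
  move=> c1 c2 c3 c4 c5.
  (* The quantifier over separations has to be decidable here. *)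
  pose bad (p : {set T} * {set T}) := [&& p.1 :|: p.2 == A', p.1 :&: p.2 == I',
     x \in p.1, y \in p.2 & r p.1 + r p.2 <= r A' + r I'].
  case: (boolP [exists p, bad p]) => [/existsP[[U V]] | /existsPn noBad].
    by case/and5P => /= /eqP ? /eqP ? ? ? ?; right; exists U, V.
  left; apply: (IHm I' A') => // U V UV UI xU yV; rewrite ltnNge.
  by apply: contra (noBad (U, V)) => le; rewrite /bad /= UV UI !eqxx xU yV.
have [|||||//|[U' [V' [UV' UI' xU' yV' le']]]] := sep (z |: I) A.
- by rewrite Azi.
- by rewrite subUset sub1set zA.
- by [].
- by rewrite !inE negb_or eq_sym nezx xNI.
- by rewrite !inE negb_or eq_sym nezy yNI.
have [|||||//|[U [V [UV UI xU yV le]]]] := sep I (A :\ z).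
- by rewrite Azd.
- by rewrite subsetD1 sIA.
- exact: subset_trans (subsetDl _ _) sAE.
- by rewrite !inE eq_sym nezx xNI.
- by rewrite !inE eq_sym nezy yNI.
(* Uncross the separation (U, V) of the deletion with the separation (U', V')
   of the contraction. *)
have cross w :
  [/\ (w \in U) || (w \in V) = (w != z) && (w \in A), (w \in U) && (w \in V) = (w \in I),
      (w \in U') || (w \in V') = (w \in A) &
      (w \in U') && (w \in V') = (w == z) || (w \in I)].
  by split; [have /setP/(_ w) := UV | have /setP/(_ w) := UI
            |have /setP/(_ w) := UV' | have /setP/(_ w) := UI']; rewrite !inE.
have lk1 : r A + r I < r (U :&: U') + r (V :|: V').
  apply: lkA; rewrite ?inE ?xU ?yV //; apply/setP => w; rewrite !inE.
    case: (cross w); case: eqP => [-> | _] /=; first by rewrite zA; do 4!case: (_ \in _).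
    by do !case: (_ \in _).
  case: (cross w); case: eqP => [-> | _] /=; first by rewrite (negPf zNI); do 4!case: (_ \in _).
  by do !case: (_ \in _).
have lk2 : r A + r I < r (U :|: U') + r (V :&: V').
  apply: lkA; rewrite ?inE ?xU ?yV //; apply/setP => w; rewrite !inE.
    case: (cross w); case: eqP => [-> | _] /=; first by rewrite zA; do 4!case: (_ \in _).
    by do !case: (_ \in _).
  case: (cross w); case: eqP => [-> | _] /=; first by rewrite (negPf zNI); do 4!case: (_ \in _).
  by do !case: (_ \in _).
have := rk_submod M U U'; have := rk_submod M V V'.
have := rk_setU1_leq z I; have := rk_mono M (subsetDl A [set z]).
by move: le le' lk1 lk2; clear; lia.
Qed.

End MatroidFacts.

Arguments proper_cyclic_flatP {T M F}.

(** * The matroid with prescribed proper cyclic flats *)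

Section SplitRank.
Variables (T I : finType) (E : {set T}) (k : nat) (P : {set I}).
Variables (R : I -> {set T}) (s : I -> nat).
Implicit Types (A B U X : {set T}) (x y : T) (i j : I).

(** Since [P] may be empty, the two terms coming from the improper cyclic flats,
    the empty set and [E], serve as the default value. *)
Definition split_rank A : nat :=
  \big[minn/minn #|A :&: E| k]_(i in P) (s i + #|(A :&: E) :\: R i|).

Variant split_rank_spec A : nat -> Prop :=
  | SplitRankCard : split_rank_spec A #|A :&: E|
  | SplitRankTop : split_rank_spec A k
  | SplitRankPart i of i \in P :
      split_rank_spec A (s i + #|(A :&: E) :\: R i|).

Lemma split_rankP A : split_rank_spec A (split_rank A).
Proof.
rewrite /split_rank.
apply: (big_ind (split_rank_spec A)); first by case: leqP; constructor.
  by move=> a b; case: (leqP a b).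
by move=> i iP; constructor.
Qed.

Lemma split_rank_leq A :
  [/\ split_rank A <= #|A :&: E|, split_rank A <= k
    & forall i, i \in P -> split_rank A <= s i + #|(A :&: E) :\: R i|].
Proof.
have le0 : split_rank A <= minn #|A :&: E| k.
  rewrite /split_rank; elim/big_rec: _ => // i a _ le_a.
  exact: leq_trans (geq_minr _ _) le_a.
split.
- exact: leq_trans le0 (geq_minl _ _).
- exact: leq_trans le0 (geq_minr _ _).
move=> i iP; rewrite /split_rank; have := mem_index_enum i.
elim: (index_enum I) => // j t IHt; rewrite in_cons big_cons.
case/predU1P => [<- | /IHt le_i]; first by rewrite iP geq_minl.
by case: ifP => // _; apply: leq_trans le_i; apply: geq_minr.
Qed.

Lemma split_rank_geq A m : m <= #|A :&: E| -> m <= k ->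
  (forall i, i \in P -> m <= s i + #|(A :&: E) :\: R i|) -> m <= split_rank A.
Proof. by move=> leA lek leP; case: split_rankP => // i /leP. Qed.

Lemma split_rank_ground A : split_rank (A :&: E) = split_rank A.
Proof. by rewrite /split_rank -setIA setIid. Qed.

Lemma split_rank_card A : split_rank A <= #|A|.
Proof.
have [leA _ _] := split_rank_leq A.
by apply: leq_trans leA _; rewrite subset_leq_card ?subsetIl.
Qed.

Lemma split_rank_mono A B : A \subset B -> split_rank A <= split_rank B.
Proof.
move=> sAB; have sABE : A :&: E \subset B :&: E by apply: setSI.
have [leA lek leP] := split_rank_leq A; case: (split_rankP B) => // [|i iP].
  by rewrite (leq_trans leA) ?subset_leq_card.
by rewrite (leq_trans (leP i iP)) // leq_add2l subset_leq_card ?setSD.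
Qed.

Hypothesis meetR : forall i j, i \in P -> j \in P -> i != j ->
  #|R i :&: R j| + k <= s i + s j.

Lemma card_meet_diff A B C D :
  #|A :&: B| <= #|C :&: D| + #|A :\: C| + #|B :\: D|.
Proof.
rewrite -addnA; apply: leq_trans (leq_add (leqnn _) (leq_card_setU _ _).1).
apply: leq_trans (leq_card_setU _ _).1; apply/subset_leq_card/subsetP => z.
by rewrite !inE; do 4!case: (z \in _).
Qed.

(** Each of [rk A] and [rk B] is one of the terms of the minimum.  Every pair of
    terms is handled by elementary counting, except for the terms of two
    different parts, which are compared with the terms [k] and [#|A :&: B|];
    this is what [meetR] is for. *)
Lemma split_rank_submod A B :
  split_rank (A :|: B) + split_rank (A :&: B) <= split_rank A + split_rank B.
Proof.
have [] := split_rank_leq (A :|: B); have [] := split_rank_leq (A :&: B).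
case: (split_rankP A) => [||i iP]; case: (split_rankP B) => [||j jP];
  rewrite setIUl setIIl; move: (split_rank (A :|: B)) (split_rank (A :&: B));
  move: (A :&: E) (B :&: E) => {}A {}B u w.
- by have := cardsUI A B; clear; lia.
- by have := subset_leq_card (subsetIl A B); clear; lia.
- move=> leI _ _ _ _ /(_ j jP); move: leI.
  have := card_meet_diff A B A (R j); have := cardsUI (A :\: R j) (B :\: R j).
  have := cardsID (R j) A; have := cardsID (R j) (A :&: B).
  rewrite -setDUl -setDIl.
  have := subset_leq_card (setSI (R j) (subsetIl A B)).
  by clear; lia.
- by have := subset_leq_card (subsetIr A B); clear; lia.
- by clear; lia.
- move=> _ _ /(_ j jP) + _ + _; have := subset_leq_card (setSD (R j) (subsetIr A B)).
  by clear; lia.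
- move=> leI _ _ _ _ /(_ i iP); move: leI.
  have := cardsUI (A :\: R i) (B :\: R i).
  have := cardsID (R i) B; have := cardsID (R i) (A :&: B).
  rewrite -setDUl -setDIl.
  have := subset_leq_card (setSI (R i) (subsetIr A B)).
  by clear; lia.
- move=> _ _ /(_ i iP) + _ + _; have := subset_leq_card (setSD (R i) (subsetIl A B)).
  by clear; lia.
case: (eqVneq i j) jP => [<- _ | neij jP].
  move=> _ _ /(_ i iP) + _ _ /(_ i iP).
  by have := cardsUI (A :\: R i) (B :\: R i); rewrite -setDUl -setDIl; clear; lia.
move=> + _ _ _ + _; have := card_meet_diff A B (R i) (R j).
by have := meetR iP jP neij; clear; lia.
Qed.

Definition split_matroid : matroid T :=
  @Matroid T E split_rank split_rank_ground split_rank_card split_rank_mono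
    split_rank_submod.

Hypothesis subR : forall i, i \in P -> R i \subset E.
Hypothesis s_gt0 : forall i, i \in P -> 0 < s i.
Hypothesis s_ltk : forall i, i \in P -> s i < k.
Hypothesis s_ltR : forall i, i \in P -> s i < #|R i|.
Hypothesis coR : forall i, i \in P -> k + #|R i| < #|E| + s i.
Hypothesis k_gt0 : 0 < k.
Hypothesis k_ltE : k < #|E|.
Hypothesis no_separation : forall i j, i \in P -> j \in P -> i != j ->
  R i :&: R j = set0 -> R i :|: R j = E -> s i + s j != k.

Local Notation N := split_matroid.

(** On [R i] the term of another part exceeds [k], so it never attains the
    minimum there. *)
Lemma card_diffR i j : i \in P -> j \in P -> i != j ->
  k < s j + #|R i :\: R j|.
Proof.
move=> iP jP neij; have := meetR iP jP neij; have := s_ltR iP.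
by have := cardsID (R j) (R i); clear; lia.
Qed.

Lemma rk_split_part i : i \in P -> rk N (R i) = s i.
Proof.
move=> iP; apply/eqP; rewrite eqn_leq; apply/andP; split.
  have [_ _ /(_ i iP)] := split_rank_leq (R i).
  by rewrite (setIidPl (subR iP)) setDv cards0 addn0.
apply: split_rank_geq; rewrite ?(setIidPl (subR iP)).
- exact: ltnW (s_ltR iP).
- exact: ltnW (s_ltk iP).
move=> j jP; case: (eqVneq i j) => [-> | neij]; first exact: leq_addr.
by have := card_diffR iP jP neij; have := s_ltk iP; clear; lia.
Qed.

Lemma rk_split_ground : rk N E = k.
Proof.
apply/eqP; rewrite eqn_leq; apply/andP; split; first by have [] := split_rank_leq E.
apply: split_rank_geq; rewrite ?setIid //; first exact: ltnW.
move=> i iP; have := coR iP; have := cardsID (R i) E.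
by rewrite (setIidPr (subR iP)); clear; lia.
Qed.

Lemma rk_splitD1 x : x \in E -> rk N (E :\ x) = k.
Proof.
move=> xE; apply/eqP; rewrite eqn_leq; apply/andP; split.
  by have [] := split_rank_leq (E :\ x).
apply: split_rank_geq => //; rewrite (setIidPl (subsetDl _ _)).
  by have := k_ltE; rewrite (cardsD1 x E) xE.
move=> i iP; have := coR iP; have := cardsID (R i) E.
rewrite (setIidPr (subR iP)) (cardsD1 x (E :\: R i)) (setDAC _ _ [set x]).
by case: (x \in _); clear; lia.
Qed.

Lemma rk_split1 x : x \in E -> rk N [set x] = 1.
Proof.
move=> xE; apply/eqP; rewrite eqn_leq; apply/andP; split.
  by rewrite (leq_trans (rk_le_card N _)) ?cards1.
apply: split_rank_geq => //; first by rewrite (setIidPl _) ?cards1 ?sub1set.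
by move=> i iP; have := s_gt0 iP; clear; lia.
Qed.

Lemma split_part_proper_cyclic_flat i :
  i \in P -> R i \in proper_cyclic_flats N.
Proof.
move=> iP; have rRi := rk_split_part iP; apply/proper_cyclic_flatP; split.
- exact: subR.
- apply/andP; split; first exact: subR.
  apply/forallP => x; apply/implyP; rewrite inE => /andP[xNR xE].
  rewrite rRi; apply: split_rank_geq; rewrite ?(setIidPl _) ?subUset ?sub1set ?xE ?subR //.
  + by rewrite cardsU1 xNR; have := s_ltR iP; clear; lia.
  + exact: s_ltk.
  move=> j jP; case: (eqVneq i j) jP => [<- _ | neij jP].
    rewrite setDUl setDv setU0 (_ : [set x] :\: R i = [set x]) ?cards1 ?addn1 //.
    by apply/setDidPl; rewrite disjoints1.
  have := card_diffR iP jP neij; have := s_ltk iP.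
  have := subset_leq_card (setSD (R j) (subsetUr [set x] (R i))).
  by clear; lia.
- move=> x xR; apply/eqP; rewrite eqn_leq rk_mono ?subsetDl // andTb rRi.
  have sDE : R i :\ x \subset E by apply: subset_trans (subsetDl _ _) (subR iP).
  apply: split_rank_geq; rewrite ?(setIidPl sDE).
  + by have := s_ltR iP; rewrite (cardsD1 x (R i)) xR; clear; lia.
  + exact: ltnW (s_ltk iP).
  move=> j jP; case: (eqVneq i j) => [-> | neij]; first exact: leq_addr.
  have := card_diffR iP jP neij; have := s_ltk iP.
  rewrite (cardsD1 x (R i :\: R j)) setDDl setUC -setDDl.
  by case: (x \in _); clear; lia.
- by rewrite -card_gt0; have := s_ltR iP; clear; lia.
- apply: contraTneq (s_ltk iP) => RE.
  by rewrite -rRi RE rk_split_ground ltnn.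
Qed.

(** The term attaining the rank of a cyclic flat [X] identifies it: the term
    [#|X|] makes [X] independent, the term [k] makes it spanning, and for the
    term of [R i] an element of [X :\: R i] would be a coloop of [X], so that [X]
    is a flat of rank [s i] inside [R i]. *)
Lemma proper_cyclic_flat_split_part X : X \in proper_cyclic_flats N ->
  exists2 i, i \in P & X = R i.
Proof.
move=> XZ; have := proper_cyclic_flat_card XZ; have := proper_cyclic_flat_rk XZ.
have [sXE fX cX X0 XE] := proper_cyclic_flatP XZ.
rewrite rk_split_ground /=; case eq_r: _ / (split_rankP X) => [||i iP].
- by rewrite (setIidPl sXE) ltnn.
- by rewrite ltnn.
move: eq_r; rewrite (setIidPl sXE) => eq_r _ _; exists i => //.
have sXR : X \subset R i.
  apply/subsetP => x xX; apply: contraT => xNR.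
  have [_ _ /(_ i iP)] := split_rank_leq (X :\ x).
  have -> : split_rank (X :\ x) = split_rank X by exact: cX.
  rewrite (setIidPl (subset_trans (subsetDl _ _) sXE)) eq_r.
  rewrite (cardsD1 x (X :\: R i)) inE xNR xX (setDAC _ _ [set x]).
  by clear; lia.
apply/eqP; rewrite eqEsubset sXR; apply: contraT => sRX.
have := flat_rk fX (subR iP); rewrite properE sXR sRX => /(_ isT).
by rewrite rk_split_part //= eq_r; clear; lia.
Qed.

(** Given [U] with [rk U + rk (E :\: U) <= k], all pairs of terms attaining the two
    ranks are excluded by counting except those of distinct parts, where
    equality must hold throughout [meetR]: then the two parts partition [E]. *)
Lemma split_matroid_connected : connected N.
Proof.
apply/andP; split; first by rewrite -card_gt0 (leq_ltn_trans _ k_ltE).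
apply/forallP => x; apply/implyP => xE; apply/forallP => y; apply/implyP => yE.
apply/implyP => nexy; suff [C [cC xC yC]] : exists C : {set T},
    [/\ circuit N C, x \in C & y \in C] by apply/existsP; exists C; rewrite cC xC.
apply: linked_circuit => // U sUE xU yNU; rewrite ltnNge; apply/negP.
rewrite rk_split_ground /=.
have cardU : 0 < #|U| by apply/card_gt0P; exists x.
have cardV : 0 < #|E :\: U| by apply/card_gt0P; exists y; rewrite inE yNU.
have cardE : #|E| = #|U| + #|E :\: U| by rewrite -(cardsID U E) (setIidPr sUE).
have diffR A B i : i \in P -> E \subset A :|: B -> k < s i + #|A :\: R i| + #|B :\: R i|.
  move=> iP sE; have := coR iP; have := cardsID (R i) E; rewrite (setIidPr (subR iP)).
  have := cardsUI (A :\: R i) (B :\: R i); rewrite -setDUl.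
  by have := subset_leq_card (setSD (R i) sE); clear; lia.
have diff_card A B : #|A :\: B| <= #|A| by rewrite subset_leq_card ?subsetDl.
have sE1 : E \subset U :|: (E :\: U) by rewrite -{1}(setID E U) (setIidPr sUE).
case: (split_rankP U) => [||i iP]; case: (split_rankP (E :\: U)) => [||j jP];
  rewrite ?(setIidPl sUE) ?(setIidPl (subsetDl E U)).
- by move: k_ltE cardE; clear; lia.
- by move: cardU; clear; lia.
- by move: (diffR _ _ j jP sE1) (diff_card U (R j)); clear; lia.
- by move: cardV; clear; lia.
- by move: k_gt0; clear; lia.
- by move: (s_gt0 jP); clear; lia.
- by move: (diffR _ _ i iP sE1) (diff_card (E :\: U) (R i)); clear; lia.
- by move: (s_gt0 iP); clear; lia.
case: (eqVneq i j) jP => [<- _ | neij jP].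
  by move: (diffR _ _ i iP sE1); clear; lia.
move=> le_k; have le_meet := meetR iP jP neij.
have [meet0 [U0 V0]] :
    #|R i :&: R j| = 0 /\ #|U :\: R i| = 0 /\ #|(E :\: U) :\: R j| = 0.
  by move: le_k le_meet; clear; lia.
have sUR : U \subset R i by rewrite -setD_eq0 -cards_eq0 U0.
have sVR : E :\: U \subset R j by rewrite -setD_eq0 -cards_eq0 V0.
have sepE : R i :|: R j = E.
  apply/eqP; rewrite eqEsubset subUset !subR //=.
  by apply: subset_trans sE1 _; apply: setUSS.
have := no_separation iP jP neij (cards0_eq meet0) sepE.
by move: le_k le_meet; rewrite meet0 U0 V0; clear; lia.
Qed.

Lemma split_matroid_elementary_split : elementary_split N.
Proof.
apply/and3P; split.
- apply/forallP => x; apply/implyP => xE; apply/negP => /circuit_rk.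
  by rewrite rk_split1 // cards1.
- apply/forallP => x; apply/implyP => xE; rewrite negb_and; apply/orP; right.
  have [B sB [rB eqB]] := indep_spanning_subset N (E :\ x).
  apply/forallPn; exists B; rewrite negb_imply; apply/andP; split; last first.
    by apply/negP => /(subsetP sB); rewrite setD11.
  have sBE : B \subset E := subset_trans sB (subsetDl _ _).
  apply/maxsetP; split; first by rewrite /indep sBE rB /=.
  move=> D /andP[sDE /eqP rD] sBD; apply/esym/eqP; rewrite eqEcard sBD.
  by rewrite -rD -rB -eqB rk_splitD1 // -[leqRHS]rk_split_ground rk_mono.
apply/forallP => X; apply/implyP => XZ; apply/forallP => Y; apply/implyP => YZ.
apply/implyP.
have [i iP ->] := proper_cyclic_flat_split_part XZ.
have [j jP ->] := proper_cyclic_flat_split_part YZ => sij.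
case: (eqVneq i j) => [-> // | neij]; have := card_diffR iP jP neij.
have := s_ltk jP; move: sij; rewrite -setD_eq0 => /eqP ->.
by rewrite cards0; clear; lia.
Qed.

End SplitRank.

(** * The sets of the reduced family *)

Lemma set_minP (T : finType) (E S : {set T}) (le : rel T) x0 :
  total_order_on E le -> S \subset E -> S != set0 ->
  set_min le x0 S \in S /\ forall y, y \in S -> le (set_min le x0 S) y.
Proof.
case=> [tot _ tr] sSE /set0Pn[z zS]; rewrite /set_min.
case: pickP => [x /andP[xS /forallP min_x] | no_min].
  by split=> // y yS; apply: (implyP (min_x y)).
(* Were there no minimum, an element with the most elements above it would have
   an element below it with even more. *)
pose up x := #|[set y in S | le x y]|.
case: (arg_maxnP up zS) => x xS max_x.
have /andP[] := no_min x; split=> //; apply/forallP => y; apply/implyP => yS.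
apply: contraT => nle_xy; have in_E := subsetP sSE.
have le_yx : le y x by case/orP: (tot x y (in_E _ xS) (in_E _ yS)) nle_xy => ->.
have: up y <= up x := max_x y yS; rewrite leqNgt => /negP[]; apply/proper_card/properP.
split; last first.
  exists y; rewrite inE yS //=.
  by case/orP: (tot y y (in_E _ yS) (in_E _ yS)).
apply/subsetP => w; rewrite !inE => /andP[wS le_xw].
by rewrite wS (tr x y w) ?in_E.
Qed.

Section Family.
Variables (T : finType) (M : matroid T) (e v : T) (le : rel T).
Implicit Types (F G X : {set T}).

Local Notation E := (ground M).
Local Notation r := (rk M).

Hypothesis le_order : total_order_on E le.
Hypothesis e_in : e \in E.
Hypothesis v_in : v \in E :\ e.

Lemma v_neq_e : v != e. Proof. by case/setD1P: v_in. Qed.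

Section In.
Variable F : {set T}.
Hypotheses (sFE : F \subset E) (eF : e \in F) (F_gt1 : 1 < #|F|).

Lemma min_F_in : set_min le e (F :\ e) \in F :\ e /\
  forall y, y \in F :\ e -> le (set_min le e (F :\ e)) y.
Proof.
apply: (@set_minP _ E) => //; first exact: subset_trans (subsetDl _ _) sFE.
by rewrite -card_gt0; move: F_gt1; rewrite (cardsD1 e F) eF.
Qed.

Lemma R_inE : exists2 w, w \in F :\ e & R_in e v le F = F :\: [set e; w] /\ v \notin F :\ w.
Proof.
rewrite /R_in; case: (boolP (v \in F)) => vF.
  by exists v; rewrite ?inE ?v_neq_e ?eqxx.
by exists (set_min le e (F :\ e)); [case: min_F_in | rewrite !inE (negPf vF) andbF].
Qed.

Lemma card_R_in : #|R_in e v le F| + 2 = #|F|.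
Proof.
have [w /setD1P[nwe wF] [-> _]] := R_inE.
have sub : [set e; w] \subset F by rewrite subUset !sub1set eF.
have := cardsID [set e; w] F; rewrite (setIidPr sub) cards2 eq_sym nwe.
by clear; lia.
Qed.

Lemma sub_R_in : R_in e v le F \subset F :\: [set e; v].
Proof.
have [w /setD1P[nwe wF] [-> vNF]] := R_inE.
apply/subsetP => z; rewrite !inE !negb_or => /andP[/andP[-> nzw] zF] /=.
rewrite zF andbT; apply: contraNneq vNF => <-.
by rewrite !inE nzw.
Qed.

End In.

Section Out.
Variable F : {set T}.
Hypotheses (sFE : F \subset E) (eNF : e \notin F) (coF_gt1 : #|F|.+1 < #|E|).

Lemma min_F_out : let y := set_min le e (E :\: (e |: F)) in
  y \in E :\: (e |: F) /\ forall z, z \in E :\: (e |: F) -> le y z.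
Proof.
apply: (@set_minP _ E) => //; first exact: subsetDl.
have sub : e |: F \subset E by rewrite subUset sub1set e_in.
rewrite -card_gt0; have := cardsID (e |: F) E; rewrite (setIidPr sub).
by rewrite cardsU1 eNF; move: coF_gt1; clear; lia.
Qed.

Lemma card_R_out : #|R_out M e v le F| = #|F|.
Proof.
rewrite /R_out; case: (boolP (v \in F)) => // vF; case: min_F_out.
set y := set_min _ _ _; rewrite inE in_setU1 negb_or => /andP[/andP[_ yNF] _] _.
by rewrite setUC cardsU1 !inE (negPf yNF) andbF (cardsD1 v F) vF.
Qed.

Lemma sub_R_out : R_out M e v le F \subset E :\: [set e; v].
Proof.
have sub : F :\ v \subset E :\: [set e; v].
  apply/subsetP => z; rewrite !inE negb_or => /andP[-> zF].
  by rewrite (subsetP sFE) // !andbT; apply: contraNneq eNF => <-.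
rewrite /R_out; case: (boolP (v \in F)) => vF; last first.
  rewrite -{1}(_ : F :\ v = F) //; apply/setDidPl.
  by rewrite disjoint_sym disjoints1.
rewrite subUset sub sub1set; case: min_F_out => + _.
set y := set_min _ _ _; rewrite !inE !negb_or => /andP[/andP[-> yNF] ->].
by rewrite andbT /=; apply: contraNneq yNF => ->.
Qed.

End Out.

Lemma meet_in_in F G : F \subset E -> G \subset E -> e \in F -> e \in G ->
  1 < #|F| -> 1 < #|G| ->
  #|R_in e v le F :&: R_in e v le G| < #|F :&: G|.
Proof.
move=> sF sG eF eG F1 G1; apply/proper_card/properP; split.
  by apply: setISS; (apply: subset_trans (subsetDl _ [set e; v]); exact: sub_R_in).
exists e; first by rewrite inE eF.
rewrite inE negb_and; apply/orP; left.
by apply/negP => /(subsetP (sub_R_in sF eF F1)); rewrite !inE eqxx.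
Qed.

(** Unless [v] is in [G] and not in [F], the sets only shrink, or [v] is lost in
    exchange for [y].  Otherwise [y] is compensated by the loss of the minimum
    [x] of [F :\ e] if [x] is in [G]; if it is not, then [y] is not gained,
    because [y] in [F] would give [x = y]. *)
Lemma meet_in_out F G : F \subset E -> G \subset E -> e \in F -> e \notin G ->
  1 < #|F| -> #|G|.+1 < #|E| ->
  #|R_in e v le F :&: R_out M e v le G| <= #|F :&: G|.
Proof.
move=> sF sG eF eNG F1 G1.
have sRF : R_in e v le F \subset F :\: [set e; v] by apply: sub_R_in.
have sRF1 : R_in e v le F \subset F := subset_trans sRF (subsetDl _ _).
rewrite /R_out; case: (boolP (v \in G)) => vG; last first.
  by apply: subset_leq_card; apply: setSI.
have [] := min_F_out sG eNG G1; set y := set_min _ _ _.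
rewrite inE in_setU1 negb_or => /andP[/andP[nye yNG] yE] min_y.
have swap w : w \in F :&: G -> w \notin R_in e v le F ->
    #|R_in e v le F :&: ((G :\ v) :|: [set y])| <= #|F :&: G|.
  move=> wFG wNR; rewrite (cardsD1 w (F :&: G)) wFG.
  have sub : R_in e v le F :&: ((G :\ v) :|: [set y]) \subset y |: ((F :&: G) :\ w).
    apply/subsetP => z; rewrite !inE => /andP[zR].
    case/orP => [/andP[_ zG] | ->] //; rewrite zG (subsetP sRF1) //= andbT.
    by apply/orP; right; apply: contraNneq wNR => <-.
  by have := subset_leq_card sub; rewrite cardsU1; case: (_ \notin _); clear; lia.
have noswap : y \notin R_in e v le F ->
    #|R_in e v le F :&: ((G :\ v) :|: [set y])| <= #|F :&: G|.
  move=> yNR; apply/subset_leq_card/subsetP => z; rewrite !inE => /andP[zR].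
  case/orP => [/andP[_ zG] | /eqP ezy]; first by rewrite zG (subsetP sRF1).
  by rewrite -ezy zR in yNR.
case: (boolP (v \in F)) => vF.
  apply: (swap v); first by rewrite inE vF.
  by apply/negP => /(subsetP sRF); rewrite !inE eqxx orbT.
have [xF min_x] := min_F_in sF eF F1.
have xNR : set_min le e (F :\ e) \notin R_in e v le F.
  by rewrite /R_in (negPf vF) !inE eqxx orbT.
case: (boolP (set_min le e (F :\ e) \in G)) => xG.
  by apply: (swap _ _ xNR); rewrite inE xG andbT; case/setD1P: xF.
apply: noswap; case: (boolP (y \in F)) => yF; last exact: contra (subsetP sRF1 y) yF.
case: le_order => _ anti _; case/setD1P: xF => nxe xF.
suff -> : y = set_min le e (F :\ e) by [].
apply: anti => //; first exact: (subsetP sF).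
rewrite min_y ?min_x // !inE ?nye //.
by rewrite negb_or nxe xG (subsetP sF).
Qed.

(** When both replacement elements are gained, [v] is lost from the
    intersection. *)
Lemma meet_out_out F G : F \subset E -> G \subset E -> e \notin F -> e \notin G ->
  #|R_out M e v le F :&: R_out M e v le G| <= #|F :&: G|.+1.
Proof.
move=> sF sG eNF eNG; rewrite /R_out.
set x := set_min _ _ _; set y := set_min _ _ _.
have addU w (A B : {set T}) : A \subset w |: B -> #|A| <= #|B|.+1.
  by move/subset_leq_card; rewrite cardsU1; case: (_ \notin _); clear; lia.
case: (boolP (v \in F)) => vF; case: (boolP (v \in G)) => vG.
- rewrite (cardsD1 v (F :&: G)) inE vF vG.
  apply: (@leq_trans #|y |: ((F :&: G) :\ v)|.+1); last first.
    by rewrite cardsU1; case: (_ \notin _); clear; lia.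
  apply: (addU x); apply/subsetP => z; rewrite !inE.
  by do !case: (_ == _); case: (z \in F); case: (z \in G).
- apply: (addU x); apply/subsetP => z; rewrite !inE.
  by do !case: (_ == _); case: (z \in F); case: (z \in G).
- apply: (addU y); apply/subsetP => z; rewrite !inE.
  by do !case: (_ == _); case: (z \in F); case: (z \in G).
exact: leqnSn.
Qed.

Definition reduced_flats : {set {set T}} :=
  [set F in proper_cyclic_flats M |
     if e \in F then 2 <= #|F| - r F else 2 <= r E - r F].

Definition reduced_set F := if e \in F then R_in e v le F else R_out M e v le F.

Definition reduced_rank F := if e \in F then r F - 1 else r F.

Lemma R_familyP X s : (X, s) \in R_family M e v le <->
  exists2 F, F \in reduced_flats & X = reduced_set F /\ s = reduced_rank F.
Proof.
rewrite /R_family mem_cat; split => [/orP[] /mapP[F] | [F]].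
- rewrite mem_filter mem_enum => /andP[/andP[eF bF] FZ] [-> ->].
  by exists F; [rewrite in_set FZ eF | rewrite /reduced_set /reduced_rank eF].
- rewrite mem_filter mem_enum => /andP[/andP[eF bF] FZ] [-> ->].
  exists F; first by rewrite in_set FZ (negPf eF).
  by rewrite /reduced_set /reduced_rank (negPf eF).
rewrite in_set /reduced_set /reduced_rank; case: ifP => eF /andP[FZ bF] [-> ->].
  by apply/orP; left; apply/mapP; exists F; rewrite // mem_filter mem_enum eF bF.
by apply/orP; right; apply/mapP; exists F; rewrite // mem_filter mem_enum eF bF.
Qed.

(** * Numerical conditions on the reduced family *)

Hypothesis M_connected : connected M.
Hypothesis M_split : elementary_split M.
Hypothesis E_gt3 : 3 < #|E|.
Hypothesis Me_del : connected (deletion M [set e]).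
Hypothesis Me_con : connected (contraction M [set e]).

Local Notation E' := (E :\: [set e; v]).
Local Notation P := reduced_flats.
Local Notation R := reduced_set.
Local Notation s := reduced_rank.

Let E_gt1 : 1 < #|E|. Proof. exact: ltn_trans E_gt3. Qed.

Lemma card_ED1 : #|E :\ e|.+1 = #|E|.
Proof. by rewrite (cardsD1 e E) e_in. Qed.

Lemma card_ED2 : #|E'|.+2 = #|E|.
Proof.
by rewrite -setDDl (cardsD1 e E) e_in (cardsD1 v (E :\ e)) v_in.
Qed.

Let ED1_gt1 : 1 < #|E :\ e|.
Proof. by rewrite -ltnS card_ED1 ltnW. Qed.

Lemma rk_deletionD1 x : x \in E :\ e -> r ((E :\ e) :\ x) = r E.
Proof.
move=> xE; have := connected_rkD1 Me_del ED1_gt1 xE.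
rewrite /= (setDAC (E :\ e) _ [set e]) (setDDl E [set e] [set e]) setUid.
by rewrite (connected_rkD1 M_connected).
Qed.

Lemma rk_contraction2 x : x \in E :\ e -> r [set x; e] = 2.
Proof.
move=> xE; have := connected_rk1 Me_con ED1_gt1 xE.
by rewrite /= (connected_rk1 M_connected) //; clear; lia.
Qed.

Lemma rk_E_gt1 : 1 < r E.
Proof. by rewrite -(rk_contraction2 v_in) -rk_ground rk_mono ?subsetIr. Qed.

Lemma rk_E_leq : (r E).+2 <= #|E|.
Proof. by rewrite -(rk_deletionD1 v_in) -card_ED2 setDDl !ltnS rk_le_card. Qed.

Lemma reduced_flatsW F : F \in P -> F \in proper_cyclic_flats M.
Proof. by rewrite in_set => /andP[]. Qed.

Lemma reduced_flats_sub F : F \in P -> F \subset E.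
Proof. by case/reduced_flatsW/proper_cyclic_flatP. Qed.

(** The bound [1 < r F] says that an element of [F :\ e] is not a loop of the
    contraction. *)
Lemma reduced_in_numbers F : F \in P -> e \in F ->
  [/\ 1 < #|F|, 1 < r F, (r F).+2 <= #|F|, #|R F| + 2 = #|F| & s F = r F - 1].
Proof.
move=> FP eF; have sFE := reduced_flats_sub FP.
move: (FP); rewrite in_set eF => /andP[FZ bF].
have F1 : 1 < #|F| by move: bF; clear; lia.
rewrite /reduced_set /reduced_rank eF card_R_in //; split=> //; last first.
  by move: bF; clear; lia.
have [x] : exists x, x \in F :\ e.
  by apply/card_gt0P; move: F1; rewrite (cardsD1 e F) eF.
case/setD1P => nxe xF; rewrite -(@rk_contraction2 x) ?inE ?nxe ?(subsetP sFE) //.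
by rewrite rk_mono // subUset !sub1set xF.
Qed.

(** The bound on [r E + #|F|] is one better than [proper_cyclic_flat_co]: it comes
    from an element outside [F] not being a coloop of the deletion. *)
Lemma reduced_out_numbers F : F \in P -> e \notin F ->
  [/\ #|F|.+1 < #|E|, 0 < r F, r E + #|F| + 2 <= #|E| + r F, (r F).+2 <= r E
    & #|R F| = #|F| /\ s F = r F].
Proof.
move=> FP eF; have sFE := reduced_flats_sub FP.
move: (FP); rewrite in_set (negPf eF) => /andP[FZ pF].
have cardD : (#|(E :\ e) :\: F| + #|F|).+1 = #|E|.
  have := cardsID F (E :\ e); rewrite (setIidPr _) ?subsetD1 ?sFE //.
  by move: card_ED1; clear; lia.
have [x xE] : exists x, x \in (E :\ e) :\: F.
  apply/card_gt0P; have := rk_leq_diff M (E :\ e) F.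
  by rewrite (connected_rkD1 M_connected) //; move: pF; clear; lia.
have coF : r E + #|F| + 2 <= #|E| + r F.
  have := rk_leq_diff M ((E :\ e) :\ x) F.
  have := cardsD1 x ((E :\ e) :\: F); rewrite xE (setDAC _ F).
  rewrite rk_deletionD1; last by case/setDP: xE.
  by move: cardD; clear; lia.
have F1 : #|F|.+1 < #|E| by move: coF pF; clear; lia.
rewrite /reduced_set /reduced_rank (negPf eF) card_R_out //.
split => //; last by move: pF; clear; lia.
have [_ _ _ /set0Pn[z zF] _] := proper_cyclic_flatP FZ.
rewrite -(connected_rk1 M_connected E_gt1 (subsetP sFE z zF)).
by rewrite rk_mono // sub1set.
Qed.

Lemma reduced_flats_meet F G : F \in P -> G \in P -> F != G ->
  #|F :&: G| + r E <= r F + r G.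
Proof. by move=> FP GP neFG; rewrite split_cyclic_flats_meet ?reduced_flatsW. Qed.

Lemma reduced_meet F G : F \in P -> G \in P -> F != G ->
  #|R F :&: R G| + (r E - 1) <= s F + s G.
Proof.
have in_out A B : A \in P -> B \in P -> A != B -> e \in A -> e \notin B ->
    #|R A :&: R B| + (r E - 1) <= s A + s B.
  move=> AP BP neAB eA eB; have le_rk := reduced_flats_meet AP BP neAB.
  have [A1 rA _ _ sA] := reduced_in_numbers AP eA.
  have [B1 _ _ _ [_ sB]] := reduced_out_numbers BP eB.
  have := meet_in_out (reduced_flats_sub AP) (reduced_flats_sub BP) eA eB A1 B1.
  rewrite sA sB /reduced_set eA (negPf eB).
  by move: le_rk rA rk_E_gt1; clear; lia.
move=> FP GP neFG; have le_rk := reduced_flats_meet FP GP neFG.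
have [sF sG] := (reduced_flats_sub FP, reduced_flats_sub GP).
case: (boolP (e \in F)) => eF; case: (boolP (e \in G)) => eG.
- have [F1 rF _ _ sF1] := reduced_in_numbers FP eF.
  have [G1 rG _ _ sG1] := reduced_in_numbers GP eG.
  have := meet_in_in sF sG eF eG F1 G1.
  rewrite sF1 sG1 /reduced_set eF eG.
  by move: le_rk rF rG rk_E_gt1; clear; lia.
- exact: in_out.
- by rewrite setIC [s F + _]addnC in_out // eq_sym.
have [_ _ _ _ [_ sF1]] := reduced_out_numbers FP eF.
have [_ _ _ _ [_ sG1]] := reduced_out_numbers GP eG.
have := meet_out_out sF sG eF eG.
rewrite sF1 sG1 /reduced_set (negPf eF) (negPf eG).
by move: le_rk rk_E_gt1; clear; lia.
Qed.

Lemma reduced_set_sub F : F \in P -> R F \subset E'.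
Proof.
move=> FP; have sFE := reduced_flats_sub FP; rewrite /reduced_set.
case: (boolP (e \in F)) => eF.
  have [F1 _ _ _ _] := reduced_in_numbers FP eF.
  exact: subset_trans (sub_R_in sFE eF F1) (setSD _ sFE).
by have [F1 _ _ _ _] := reduced_out_numbers FP eF; apply: sub_R_out.
Qed.

Lemma reduced_rank_gt0 F : F \in P -> 0 < s F.
Proof.
move=> FP; case: (boolP (e \in F)) => eF.
  by have [_ + _ _ ->] := reduced_in_numbers FP eF; clear; lia.
by have [_ + _ _ [_ ->]] := reduced_out_numbers FP eF.
Qed.

Lemma reduced_rank_ltn F : F \in P -> s F < r E - 1.
Proof.
move=> FP; case: (boolP (e \in F)) => eF.
  have [_ + _ _ ->] := reduced_in_numbers FP eF.
  by have := proper_cyclic_flat_rk (reduced_flatsW FP); clear; lia.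
by have [_ _ _ + [_ ->]] := reduced_out_numbers FP eF; clear; lia.
Qed.

Lemma reduced_rank_ltn_card F : F \in P -> s F < #|R F|.
Proof.
move=> FP; case: (boolP (e \in F)) => eF.
  by have [_ + + + ->] := reduced_in_numbers FP eF; clear; lia.
have [_ _ _ _ [-> ->]] := reduced_out_numbers FP eF.
exact: proper_cyclic_flat_card (reduced_flatsW FP).
Qed.

Lemma reduced_co F : F \in P -> r E - 1 + #|R F| < #|E'| + s F.
Proof.
move=> FP; case: (boolP (e \in F)) => eF.
  have [_ + _ + ->] := reduced_in_numbers FP eF.
  have := proper_cyclic_flat_co M_connected E_gt1 (reduced_flatsW FP).
  by move: card_ED2 rk_E_gt1; clear; lia.
have [_ _ + _ [-> ->]] := reduced_out_numbers FP eF.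
by move: card_ED2 rk_E_gt1; clear; lia.
Qed.

(** If [e] is in both flats, the ranks allow [F :&: G] to have only one element
    while the sizes require two; if [e] is in neither, the ranks violate
    [reduced_flats_meet]; and if [e] is in just one of them, then [F] and [G]
    themselves separate [M]. *)
Lemma reduced_no_separation F G : F \in P -> G \in P -> F != G ->
  R F :&: R G = set0 -> R F :|: R G = E' -> s F + s G != r E - 1.
Proof.
have in_out A B : A \in P -> B \in P -> A != B -> e \in A -> e \notin B ->
    #|R A| + #|R B| + 2 = #|E| -> s A + s B != r E - 1.
  move=> AP BP neAB eA eB cardAB; apply/eqP => sAB.
  have le_rk := reduced_flats_meet AP BP neAB.
  have [_ rA _ cA sA] := reduced_in_numbers AP eA.
  have [_ rB _ _ [cB sB]] := reduced_out_numbers BP eB.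
  have meet0 : #|A :&: B| = 0.
    by move: le_rk sAB rA rk_E_gt1; rewrite sA sB; clear; lia.
  have rAB : r A + r B = r E.
    by move: sAB rA rk_E_gt1; rewrite sA sB; clear; lia.
  have AUB : A :|: B = E.
    apply/eqP; rewrite eqEcard subUset !reduced_flats_sub //=.
    by move: cardAB cA cB meet0 (cardsUI A B); clear; lia.
  have BD : B = E :\: A.
    apply/setP => z; rewrite -AUB !inE; move/cards0_eq/setP/(_ z): meet0.
    by rewrite !inE; do 2!case: (_ \in _).
  have [_ _ _ /set0Pn[z zB] _] := proper_cyclic_flatP (reduced_flatsW BP).
  have := @connected_separation T M A e z M_connected (reduced_flats_sub AP) eA.
  by rewrite -BD zB rAB ltnn => /(_ isT).
move=> FP GP neFG RFG0 RFG.
have cardFG : #|R F| + #|R G| + 2 = #|E|.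
  by rewrite -cardsUI RFG RFG0 cards0 -card_ED2; clear; lia.
have le_rk := reduced_flats_meet FP GP neFG.
case: (boolP (e \in F)) => eF; case: (boolP (e \in G)) => eG.
- apply/eqP => sFG; have [_ rF _ cF sF] := reduced_in_numbers FP eF.
  have [_ rG _ cG sG] := reduced_in_numbers GP eG.
  have := cardsUI F G; have : #|F :|: G| <= #|E|.
    by rewrite subset_leq_card // subUset !reduced_flats_sub.
  by move: le_rk sFG rF rG cF cG cardFG rk_E_gt1; rewrite sF sG; clear; lia.
- exact: in_out.
- by rewrite addnC; apply: in_out; rewrite // 1?eq_sym // [#|R G| + _]addnC.
apply/eqP => sFG; have [_ _ _ _ [_ sF]] := reduced_out_numbers FP eF.
have [_ _ _ _ [_ sG]] := reduced_out_numbers GP eG.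
by move: le_rk sFG rk_E_gt1; rewrite sF sG; clear; lia.
Qed.

End Family.

Theorem proposition5p2 (T : finType) (M : matroid T) (n k : nat)
    (e v : T) (le : rel T)
    (M_connected : connected M) (M_split : elementary_split M)
    (M_rank : rk M (ground M) = k) (M_card : #|ground M| = n)
    (n_ge4 : 4 <= n)
    (e_in : e \in ground M)
    (Me_del : connected (deletion M [set e]))
    (Me_con : connected (contraction M [set e]))
    (v_in : v \in ground M :\ e)
    (le_order : total_order_on (ground M) le) :
  exists N : matroid T,
    [/\ ground N = ground M :\: [set e; v],
        rk N (ground N) = k - 1,
        connected N,
        elementary_split N &
        (forall X : {set T}, X \in proper_cyclic_flats N <->
           exists s : nat, (X, s) \in R_family M e v le) /\
        (forall (X : {set T}) (s : nat),
           (X, s) \in R_family M e v le -> rk N X = s)].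
Proof.
have n_ge4' : 3 < #|ground M| by rewrite M_card.
have meet := reduced_meet le_order e_in v_in M_connected M_split n_ge4' Me_del Me_con.
have sR := reduced_set_sub le_order e_in v_in M_connected n_ge4' Me_del Me_con.
have s_gt0 := reduced_rank_gt0 le_order e_in v_in M_connected n_ge4' Me_del Me_con.
have s_ltk := reduced_rank_ltn le_order e_in v_in M_connected n_ge4' Me_del Me_con.
have s_ltR := reduced_rank_ltn_card le_order e_in v_in M_connected n_ge4' Me_del Me_con.
have coR := reduced_co le_order e_in v_in M_connected n_ge4' Me_del Me_con.
have nsep := reduced_no_separation le_order e_in v_in M_connected M_split n_ge4' Me_del Me_con.
have k_gt1 := rk_E_gt1 e_in v_in M_connected n_ge4' Me_con.
have k1_gt0 : 0 < rk M (ground M) - 1 by rewrite subn_gt0.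
have k1_lt : rk M (ground M) - 1 < #|ground M :\: [set e; v]|.
  have := rk_E_leq e_in v_in M_connected n_ge4' Me_del.
  by move: (card_ED2 e_in v_in) k_gt1; clear; lia.
exists (split_matroid (ground M :\: [set e; v]) meet); split => //.
- by rewrite -M_rank; apply: rk_split_ground.
- exact: split_matroid_connected.
- exact: split_matroid_elementary_split.
split => [X | X t /R_familyP[F FP [-> ->]]]; last exact: rk_split_part.
split => [/(proper_cyclic_flat_split_part sR s_ltk s_ltR coR k1_lt)[F FP ->] | [t]].
  by exists (reduced_rank M e F); apply/R_familyP; exists F.
by case/R_familyP => F FP [-> _]; apply: split_part_proper_cyclic_flat.
Qed.
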